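(* Let $n,p$ be positive integers, let $k\in\{1,\dots,n\}$ and let $0=s_0<s_1<\cdots<s_k\le n$ be integers; put $s_{k+1}:=n$. Let $P_{unif}(s_1,\dots,s_k)$ (resp. $P'_{unif}(s_1,\dots,s_k)$) be the probability that a uniformly distributed random element of $G_{p,n}$ has its set of positions of d-descents (resp. d'-descents) exactly equal to $\{s_1,\dots,s_k\}$. Then the following hold. (1) d-descents. (i) If $s_k<n$, then $P_{unif}(s_1,\dots,s_k)=\det\bigl(g(i,j)\bigr)_{i,j=0,\dots,k}$, where $$g(i,j)=\begin{cases}\dfrac{1}{(s_{j+1}-s_i)!} & (0\le i\le k,\ 0\le j\le k-1),\\[3mm] \dfrac{1}{(s_{j+1}-s_i)!}\left(\dfrac1p\right)^{s_{j+1}-s_i} & (0\le i\le k,\ j=k).\end{cases}$$ (ii) If $s_k=n$, then $P_{unif}(s_1,\dots,s_{k-1},n)=\det\bigl(g(i,j)\bigr)_{i,j=0,\dots,k-1}$, where $$g(i,j)=\begin{cases}\dfrac{1}{(s_{j+1}-s_i)!} & (0\le i\le k-1,\ 0\le j\le k-2),\\[3mm] \dfrac{1}{(s_{j+1}-s_i)!}\left(1-\left(\dfrac1p\right)^{s_{j+1}-s_i}\right) & (0\le i\le k-1,\ j=k-1).\end{cases}$$ (2) d'-descents. Let $p^*$ be the dual exponent of $p$, i.e. $\frac1p+\frac1{p^*}=1$ (so $\frac1{p^*}=1-\frac1p$). (i) If $s_k<n$, then $P'_{unif}(s_1,\dots,s_k)=\det\bigl(g'(i,j)\bigr)_{i,j=0,\dots,k}$,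 where $$g'(i,j)=\begin{cases}\dfrac{1}{(s_{j+1}-s_i)!} & (0\le i\le k,\ 0\le j\le k-1),\\[3mm] \dfrac{1}{(s_{j+1}-s_i)!}\left(\dfrac1{p^*}\right)^{s_{j+1}-s_i} & (0\le i\le k,\ j=k).\end{cases}$$ (ii) If $s_k=n$, then $P'_{unif}(s_1,\dots,s_{k-1},n)=\det\bigl(g'(i,j)\bigr)_{i,j=0,\dots,k-1}$, where $$g'(i,j)=\begin{cases}\dfrac{1}{(s_{j+1}-s_i)!} & (0\le i\le k-1,\ 0\le j\le k-2),\\[3mm] \dfrac{1}{(s_{j+1}-s_i)!}\left(1-\left(\dfrac1{p^*}\right)^{s_{j+1}-s_i}\right) & (0\le i\le k-1,\ j=k-1).\end{cases}$$
   Context: Colored permutations. Let $[n]=\{1,\dots,n\}$, $\Sigma=[n]\times\mathbf{Z}_p$ with $\mathbf{Z}_p=\mathbf{Z}/p\mathbf{Z}$ (elements represented by $0,1,\dots,p-1$), and $T_q(i,r)=(i,r+q)$ for $q \in \mathbf{Z}_p$. $G_{p,n}$ is the group of bijections $\sigma:\Sigma\to\Sigma$ with $\sigma\circ T_1=T_1\circ\sigma$. An element $\sigma\in G_{p,n}$ is determined by the pairs $(\sigma(i),\sigma_c(i)):=\sigma(i,0)$, $i\in[n]$. d-descents. Order $\Sigma$ linearly by $(1,0)<(2,0)<\cdots<(n,0)<(1,p-1)<\cdots<(n,p-1)<(1,p-2)<\cdots<(n,p-2)<\cdots<(1,1)<\cdots<(n,1)$. $\sigma\in G_{p,n}$ has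 a d-descent at $i$, for $1\le i\le n-1$, iff $(\sigma(i),\sigma_c(i))>(\sigma(i+1),\sigma_c(i+1))$; it has a d-descent at $n$ iff $\sigma_c(n)\ne 0$. d'-descents. Order $\Sigma$ linearly by the dash-order $(1,0)<'(2,0)<'\cdots<'(n,0)<'(1,1)<'\cdots<'(n,1)<'\cdots<'(1,p-1)<'\cdots<'(n,p-1)$. $\sigma$ has a d'-descent at $i$, for $1\le i\le n-1$, iff $(\sigma(i),\sigma_c(i))>'(\sigma(i+1),\sigma_c(i+1))$; it has a d'-descent at $n$ iff $\sigma_c(n)=p-1$. Convention: $1/m!=0$ for integers $m<0$. *)

(* Defs.v *)
From HB Require Import structures.
From mathcomp Require Import all_boot all_order all_algebra all_fingroup.

Set Implicit Arguments.
Unset Strict Implicit.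
Unset Printing Implicit Defensive.

Import GRing.Theory.
Local Open Scope ring_scope.

(* For p > 0 the type 'I_p.-1.+1, with the library's addition modulo p, is
   Z/pZ.  The library's 'Z_p is not used since 'Z_1 has two elements. *)
Notation Zmod p := 'I_p.-1.+1.

(* The ordinal i : 'I_n stands for the integer i.+1 of {1, ..., n}. *)
Definition Sigma (n p : nat) : finType := ('I_n * Zmod p)%type.

Definition T (n p : nat) (q : Zmod p) (x : Sigma n p) : Sigma n p :=
  (x.1, x.2 + q).

Definition G (n p : nat) : {set {perm Sigma n p}} :=
  [set sigma : {perm Sigma n p} |
    [forall x, sigma (T (inZp 1) x) == T (inZp 1) (sigma x)]].

Lemma G_group_set (n p : nat) : group_set (G n p).
Proof.
apply/group_setP; split=> [|s t].
  by rewrite inE; apply/forallP=> x; rewrite !perm1.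
rewrite !inE => /forallP hs /forallP ht; apply/forallP=> x.
by rewrite !permM (eqP (hs x)) (eqP (ht (s x))).
Qed.

Canonical G_group (n p : nat) : {group {perm Sigma n p}} :=
  Group (G_group_set n p).

(* The colour blocks come in the order 0, p-1, p-2, ..., 1, so the block of
   colour r has rank - r, computed in Z/pZ and read in {0, ..., p-1}. *)
Definition d_lt (n p : nat) (x y : Sigma n p) : bool :=
  ((- x.2 : Zmod p) < (- y.2 : Zmod p))%N || ((x.2 == y.2) && (x.1 < y.1)%N).

Definition d'_lt (n p : nat) (x y : Sigma n p) : bool :=
  (x.2 < y.2)%N || ((x.2 == y.2) && (x.1 < y.1)%N).

(* [val0 sigma i] is the pair (sigma(i), sigma_c(i)). *)
Definition val0 (n p : nat) (sigma : {perm Sigma n p}) (i : 'I_n) : Sigma n p :=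
  sigma (i, 0).

(* The last position is the i with i.+1 = n; at the other positions the cyclic
   successor ordS i is the next position. *)
Definition d_descent (n p : nat) (sigma : {perm Sigma n p}) (i : 'I_n) : bool :=
  if i.+1 == n then (val0 sigma i).2 != 0
  else d_lt (val0 sigma (ordS i)) (val0 sigma i).

Definition d'_descent (n p : nat) (sigma : {perm Sigma n p}) (i : 'I_n) : bool :=
  if i.+1 == n then (val0 sigma i).2 == p.-1 :> nat
  else d'_lt (val0 sigma (ordS i)) (val0 sigma i).

Definition positions (n k : nat) (s : nat -> nat) : {set 'I_n} :=
  [set i : 'I_n | i.+1 \in [seq s j | j <- iota 1 k]].

Definition unif_prob (T : finType) (A : {set T}) (E : pred T) : rat :=
  #|[set x in A | E x]|%:R / #|A|%:R.

Definition P_unif (n p k : nat) (s : nat -> nat) : rat :=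
  unif_prob (G n p)
    (fun sigma => [set i | d_descent sigma i] == positions n k s).

Definition P'_unif (n p k : nat) (s : nat -> nat) : rat :=
  unif_prob (G n p)
    (fun sigma => [set i | d'_descent sigma i] == positions n k s).

Definition inv_fact (m : int) : rat :=
  if m is Posz a then (a`!%:R)^-1 else 0.

(* 1/p^*, which is 0 for p = 1 (where p^* is infinite). *)
Definition inv_dual (p : nat) : rat := 1 - p%:R^-1.

(* Main.v *)
Require Import Defs.
From mathcomp Require Import all_boot all_order all_algebra all_fingroup.
From mathcomp Require Import zify.

(** Both orders on Sigma compare colours first, and both fit one pattern: the
   elements are ordered by an injective key, and the position n is not a
   descent exactly when the last colour lies in a set C of colours that is an
   initial part of the order.  For d-descents C = {0}; for d'-descents C is
   the complement of {p-1}.  The only trace of the order in the answer is the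
   ratio x = |C|/p, that is 1/p, respectively 1/p^*.

   For i <= m <= k let e(i,m) be the probability that the descents at the
   positions beyond s_i are exactly s_{m+1}, ..., s_k; the theorem asks for
   e(0,0).  Asking instead that the positions strictly between s_i and
   s_{m+1} be ascents, that those beyond s_{m+1} have descents s_{m+2}, ...,
   s_k, and leaving s_{m+1} itself free, gives two disjoint cases, counted by
   e(i,m) and e(i,m+1).  The two requirements are independent and the first
   one has probability 1/(s_{m+1}-s_i)!, because exactly one rearrangement of
   the values in the block is increasing.  Hence
     e(i,m) = e(m+1,m+1) / (s_{m+1}-s_i)! - e(i,m+1).
   When no descent is allowed beyond s_i, the values there increase and the
   last colour is in C, which forces all of these colours into C; so
   e(i,k) = x^(n-s_i) / (n-s_i)!.

   The matrices of the theorem are of Hessenberg form with ones below the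
   diagonal, and expanding such a determinant along its first column gives the
   same recursion ([det_hessenberg]).  If s_k = n, then e(k,k) = 1, and one
   step of the recursion turns the initial values e(i,k) into the last column
   e(i,k-1) = (1 - x^(n-s_i)) / (n-s_i)! of the smaller matrix.

   Both probabilities come from one double count ([unif_prob_average]):
   translate a random element by a family of group elements, permutations of
   the positions in a block or shifts of the colours, and count how many
   translates of a fixed element have the property. *)

Set Implicit Arguments.
Unset Strict Implicit.
Unset Printing Implicit Defensive.

Import GRing.Theory Num.Theory.
Local Open Scope ring_scope.

(** * Hessenberg determinants *)

(** [e i m] is the determinant of the lower right block with indices at least
   [m] in which row [m] is replaced by row [i].  Its first column has at most two
   nonzero entries, [M i m] and a one, so the expansion along this column is
   the recursion for [e]. *)
Lemma det_hessenberg (R : comNzRingType) (K : nat) (M e : nat -> nat -> R) :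
    (forall i j, (j < i <= K)%N -> M i j = (i == j.+1)%:R) ->
    (forall i, (i <= K)%N -> e i K = M i K) ->
    (forall i m, (i <= m)%N -> (m < K)%N ->
       e i m = M i m * e m.+1 m.+1 - e i m.+1) ->
  \det (\matrix_(i < K.+1, j < K.+1) M i j) = e 0 0.
Proof.
move=> M_low e_last e_rec.
pose N d i m : 'M[R]_d.+1 :=
  \matrix_(a, b) M (if a == 0 :> nat then i else m + a)%N (m + b)%N.
have detN d : forall i m, (i <= m)%N -> (m + d = K)%N -> \det (N d i m) = e i m.
  elim: d => [|d IHd] i m le_im def_K.
    rewrite addn0 in def_K.
    by rewrite det_mx11 mxE /= addn0 def_K e_last // -def_K.
  have lt_mK : (m < K)%N by lia.
  rewrite (expand_det_col _ ord0) 2!big_ord_recl big1 => [|a _]; last first.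
    rewrite mxE /= addn0 -[bump 0 (bump 0 _)]/(a.+2).
    rewrite M_low; last by have := ltn_ord a; lia.
    by rewrite (introF eqP) ?mul0r //; lia.
  rewrite addr0 !mxE /= addn0 -[bump 0 0]/1%N addn1.
  rewrite [M m.+1 m]M_low ?ltnSn // eqxx mul1r /cofactor /=.
  rewrite add0n addn0 expr1 mulN1r mul1r.
  have IH1 : \det (N d m.+1 m.+1) = e m.+1 m.+1 by apply: IHd => //; lia.
  have IH2 : \det (N d i m.+1) = e i m.+1 by apply: IHd; lia.
  rewrite e_rec // -IH1 -IH2.
  have -> : row' ord0 (col' ord0 (N d.+1 i m)) = N d m.+1 m.+1.
    by apply/matrixP=> a b; rewrite !mxE /= /bump; congr M; [case: eqP|]; lia.
  have -> // : row' (lift ord0 ord0) (col' ord0 (N d.+1 i m)) = N d i m.+1.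
  apply/matrixP=> a b; rewrite !mxE /= /bump.
  by congr M; case: a => [[|a] /= _] //; lia.
rewrite -(detN K) //; congr (\det _); apply/matrixP=> a b; rewrite !mxE.
by congr M; case: eqP.
Qed.

(** * Uniform probabilities on a finite group *)

Lemma unif_prob_ext (T : finType) (A : {set T}) (E F : pred T) :
  {in A, E =1 F} -> unif_prob A E = unif_prob A F.
Proof.
move=> eqEF; rewrite /unif_prob; congr (_%:R / _); apply: eq_card => x.
by rewrite !inE; case: (boolP (x \in A)) => // /eqEF ->.
Qed.

Lemma unif_prob_diff (T : finType) (A : {set T}) (E F : pred T) :
  unif_prob A (fun x => E x && ~~ F x)
    = unif_prob A E - unif_prob A (fun x => E x && F x).
Proof.
rewrite /unif_prob -mulrBl; congr (_ / _).
apply/eqP; rewrite eq_sym subr_eq -natrD; apply/eqP; congr _%:R.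
rewrite -(cardsID [set x | F x]) addnC; congr (_ + _)%N; apply: eq_card => x.
  by rewrite !inE; case: (x \in A); case: (E x); case: (F x).
by rewrite !inE; case: (x \in A); case: (E x); case: (F x).
Qed.

Lemma unif_probT (gT : finGroupType) (H : {group gT}) :
  unif_prob H predT = 1.
Proof.
rewrite /unif_prob (eq_card (B := H)); last by move=> x; rewrite inE andbT.
by rewrite divff // pnatr_eq0 -lt0n cardG_gt0.
Qed.

(** Translation by [h i] preserves the uniform distribution and the event [F],
   so [F && E] has the same probability as [F] together with the translate of
   [E]; summing over [i] counts each element of [F] exactly [c] times. *)
Lemma unif_prob_average (gT : finGroupType) (H : {group gT}) (I : finType)
    (J : {set I}) (h : I -> gT) (F E : pred gT) (c : nat) :
    (forall i, i \in J -> h i \in H) ->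
    (forall i x, i \in J -> F (h i * x)%g = F x) ->
    (forall x, x \in H -> #|[set i in J | E (h i * x)%g]| = c) ->
  #|J|%:R * unif_prob H (fun x => F x && E x) = c%:R * unif_prob H F.
Proof.
move=> hH F_inv E_count; rewrite /unif_prob !mulrA -!natrM; congr (_%:R / _).
transitivity (\sum_(i in J) #|[set x in H | F x && E (h i * x)%g]|)%N.
  rewrite -sum_nat_const; apply: eq_bigr => i Ji.
  rewrite -[RHS](card_imset _ (mulgI (h i))); apply: eq_card => y.
  apply/idP/imsetP => [|[x]].
    rewrite inE => /andP[Hy FEy]; exists ((h i)^-1 * y)%g; last by rewrite mulKVg.
    by rewrite inE -(F_inv i _ Ji) mulKVg FEy groupM ?groupV ?hH.
  by rewrite !inE => /and3P[Hx Fx Ex] ->; rewrite F_inv // Fx Ex groupM ?hH.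
transitivity (\sum_(i in J) \sum_(x in [set x in H | F x]) E (h i * x)%g)%N.
  apply: eq_bigr => i _; rewrite -sum1_card big_mkcond [RHS]big_mkcond /=.
  by apply: eq_bigr => x _; rewrite !inE; case: (x \in H); case: (F x); case: (E _).
rewrite exchange_big /= mulnC -sum_nat_const; apply: eq_bigr => x.
rewrite inE => /andP[Hx _]; rewrite -(E_count x Hx) -sum1_card.
rewrite big_mkcond [RHS]big_mkcond /=.
by apply: eq_bigr => i _; rewrite !inE; case: (i \in J); case: (E _).
Qed.

(** * Sorting the values in a block of positions *)

Definition ascending (n a b : nat) (v : 'I_n -> nat) : bool :=
  [forall i : 'I_n, (a <= i)%N && (i.+1 < b)%N ==> (v i <= v (ordS i))%N].

Lemma ascendingP (n a b : nat) (v : 'I_n -> nat) : (b <= n)%N ->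
  reflect (forall i j : 'I_n, (a <= i <= j)%N -> (j < b)%N -> (v i <= v j)%N)
          (ascending a b v).
Proof.
move=> le_bn; apply: (iffP forallP) => [asc i j | v_mono i].
  move=> /andP[le_ai]; move: {2}(j - i)%N (erefl (j - i)%N) => d.
  elim: d j => [|d IHd] j def_d le_ij lt_jb.
    by rewrite (_ : i = j) //; apply/val_inj => /=; lia.
  have lt_j1n : (j.-1 < n)%N by lia.
  have := asc (Ordinal lt_j1n); rewrite /= (_ : (_ <= _)%N && _); last lia.
  rewrite (_ : ordS _ = j); last first.
    by apply/val_inj; rewrite /= prednK ?modn_small //; lia.
  by apply: leq_trans; apply: IHd => /=; lia.
apply/implyP => /andP[le_ai lt_ib].
have lt_in : (i.+1 < n)%N := leq_trans lt_ib le_bn.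
by apply: v_mono; rewrite /= modn_small ?le_ai /= ?leqnSn.
Qed.

Definition block (n a b : nat) : {set 'I_n} := [set i : 'I_n | (a <= i < b)%N].

Lemma card_block (n a b : nat) : (b <= n)%N -> #|block n a b| = (b - a)%N.
Proof.
move=> le_bn; rewrite -[RHS]card_ord.
have lt_n (i : 'I_(b - a)) : (a + i < n)%N by have := ltn_ord i; lia.
pose f (i : 'I_(b - a)) := Ordinal (lt_n i).
have f_inj : injective f by move=> i j [/addnI/val_inj].
rewrite -[RHS](card_imset _ f_inj); apply: eq_card => i; rewrite inE.
apply/idP/imsetP => [/andP[le_ai lt_ib]|[j _ ->] /=]; last first.
  by have := ltn_ord j; lia.
have lt_i : (i - a < b - a)%N by lia.
by exists (Ordinal lt_i) => //; apply/val_inj => /=; lia.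
Qed.

(** The unique sorting permutation is the inverse of the map [rho] that sends
   [x] in the block to the place given by the number of smaller values. *)
Lemma card_sorting_perm (n a b : nat) (v : 'I_n -> nat) :
    (b <= n)%N -> injective v ->
  #|[set pi in [set pi | perm_on (block n a b) pi] | ascending a b (v \o pi)]|
    = 1%N.
Proof.
move=> le_bn v_inj; set A := block n a b.
pose below x := [set j in A | (v j < v x)%N].
have below_lt x : x \in A -> (a + #|below x| < b)%N.
  move=> Ax; have : (#|below x| < #|A|)%N.
    apply: proper_card; apply/properP; split.
      by apply/subsetP => j; rewrite inE => /andP[].
    by exists x => //; rewrite inE ltnn andbF.
  by rewrite card_block //; lia.
have below_mono x y : x \in A -> (v x < v y)%N -> (#|below x| < #|below y|)%N.
  move=> Ax lt_xy; apply: proper_card; apply/properP; split.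
    apply/subsetP => j; rewrite !inE => /andP[-> /ltn_trans]; exact.
  by exists x; rewrite inE ?ltnn ?andbF // lt_xy andbT.
pose rho x : 'I_n := if x \in A then insubd x (a + #|below x|)%N else x.
have rhoE x : x \in A -> rho x = (a + #|below x|)%N :> nat.
  move=> Ax; rewrite /rho Ax val_insubd ifT //.
  exact: leq_trans (below_lt x Ax) le_bn.
have rhoA x : (rho x \in A) = (x \in A).
  have [Ax|nAx] := boolP (x \in A); last first.
    by rewrite /rho (negPf nAx) (negPf nAx).
  by rewrite inE rhoE // leq_addr below_lt.
have rho_mono x y : x \in A -> y \in A -> (rho x <= rho y)%N = (v x <= v y)%N.
  move=> Ax Ay; rewrite !rhoE // leq_add2l.
  have [lt_xy|lt_yx|/v_inj->] := ltngtP (v x) (v y); last by rewrite leqnn.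
    by rewrite ltnW // below_mono.
  by apply/negbTE; rewrite -ltnNge below_mono.
have rho_inj : injective rho.
  move=> x y eq_xy; have := congr1 (mem A) eq_xy; rewrite /= !rhoA.
  have [Ax|nAx] := boolP (x \in A) => Ay.
    by apply/v_inj/anti_leq; rewrite -!rho_mono -?Ay // eq_xy leqnn.
  by move: eq_xy; rewrite /rho -Ay (negPf nAx).
pose tau := perm rho_inj.
have tau_on : perm_on A tau.
  by apply/subsetP=> x; rewrite inE permE /rho; case: ifP; rewrite ?eqxx.
apply/eqP/cards1P; exists (tau^-1)%g; apply/setP => pi; rewrite !inE.
apply/andP/eqP => [[pi_on /(ascendingP _ _ le_bn) asc]|->].
  apply: (mulIg tau); rewrite mulVg; apply/permP => x; rewrite permM perm1 permE.
  have [Ax|nAx] := boolP (x \in A); last first.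
    by rewrite /rho (out_perm pi_on nAx) (negPf nAx).
  have Apix : pi x \in A by rewrite perm_closed.
  have [le_ax lt_xb] : (a <= x)%N /\ (x < b)%N.
    by move: Ax; rewrite inE => /andP[].
  apply/val_inj; rewrite /= rhoE //.
  (* Since v \o pi increases, the values below v (pi x) are those placed before
     x; hence rho inverts any sorting permutation. *)
  have -> : below (pi x) = pi @: block n a x.
    apply/setP => y; rewrite -[y](permKV pi) mem_imset; last exact: perm_inj.
    rewrite [in LHS]inE (perm_closed _ pi_on) [in RHS]inE; move: (_ y) => j.
    apply/andP/andP => [[]|[le_aj lt_jx]].
      rewrite inE => /andP[le_aj lt_jb] lt_v; split=> //; rewrite ltnNge.
      by apply: contraL lt_v => le_xj; rewrite -leqNgt asc ?le_ax.
    split; first by rewrite inE le_aj (ltn_trans lt_jx).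
    have /= le_v := asc j x.
    rewrite ltn_neqAle le_v ?le_aj ?andbT //; last exact: ltnW.
    by apply: contraTneq lt_jx => /v_inj/perm_inj ->; rewrite ltnn.
  rewrite card_imset; last exact: perm_inj.
  by rewrite card_block ?subnKC // ltnW.
split; first exact: perm_onV.
apply/(ascendingP _ _ le_bn) => i j /andP[le_ai le_ij] lt_jb /=.
have tauE x : tau x = rho x by rewrite permE.
have rhoV x : rho ((tau^-1)%g x) = x by rewrite -tauE permKV.
rewrite -rho_mono ?rhoV // -rhoA rhoV inE.
  by rewrite le_ai (leq_ltn_trans le_ij).
by rewrite lt_jb (leq_trans le_ai).
Qed.

(** * Descents of coloured permutations *)

Section ColoredPermutations.

Variables n p : nat.
Implicit Types (s : {perm Sigma n p}) (pi : {perm 'I_n}).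

Lemma G_commute_T s (q : Zmod p) x : s \in G n p -> s (T q x) = T q (s x).
Proof.
rewrite inE => /forallP s_comm; rewrite -[q]valZpK.
elim: (val q) x => [|m IHm] x.
  rewrite (_ : inZp 0 = 0) /T ?addr0; last exact/val_inj.
  by rewrite -!surjective_pairing.
have TS y : T (inZp m.+1) y = T (inZp 1) (T (inZp m) y) :> Sigma n p.
  rewrite /T /= -addrA; congr (_, _ + _); apply/val_inj.
  by rewrite /= modnDm addn1.
by rewrite !TS (eqP (s_comm _)) IHm.
Qed.

Lemma move_positions_subproof pi :
  injective (fun x : Sigma n p => (pi x.1, x.2) : Sigma n p).
Proof. by move=> [i q] [j r] [/perm_inj -> ->]. Qed.

(** Products of permutations act on the left factor first, so multiplying by
   [move_positions pi] on the left rearranges the word of [s] by [pi]. *)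
Definition move_positions pi : {perm Sigma n p} :=
  perm (@move_positions_subproof pi).

Lemma move_positions_in_G pi : move_positions pi \in G n p.
Proof. by rewrite inE; apply/forallP=> x; rewrite !permE. Qed.

Lemma val0_move_positions pi s i :
  val0 (move_positions pi * s)%g i = val0 s (pi i).
Proof. by rewrite /val0 permM permE. Qed.

Lemma shift_colors_subproof (c : {ffun 'I_n -> Zmod p}) :
  injective (fun x : Sigma n p => (x.1, x.2 + c x.1) : Sigma n p).
Proof.
move=> [i q] [j r] eq_xy; have /= eq_ij := congr1 fst eq_xy.
by have /= := congr1 snd eq_xy; rewrite eq_ij => /addIr ->.
Qed.

Definition shift_colors c : {perm Sigma n p} :=
  perm (@shift_colors_subproof c).

Lemma shift_colors_in_G c : shift_colors c \in G n p.
Proof. by rewrite inE; apply/forallP=> x; rewrite !permE /T /= addrAC. Qed.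

Lemma color_shift_colors c s i : s \in G n p ->
  (val0 (shift_colors c * s)%g i).2 = (val0 s i).2 + c i.
Proof.
move=> Gs; rewrite /val0 permM permE /=.
by rewrite -[(i, _)]/(T (c i) (i, 0)) G_commute_T.
Qed.

Variables (key : Sigma n p -> nat) (C : {set Zmod p}).
Hypothesis key_inj : injective key.
(** [C] is an initial part of the order of the colour blocks. *)
Hypothesis C_down : forall x y, (key y <= key x)%N -> x.2 \in C -> y.2 \in C.

Lemma val0_inj s : injective (fun i => key (val0 s i)).
Proof. by move=> i j /key_inj/perm_inj[]. Qed.

(** An event that is insensitive to rearrangements of the block is independent
   of the values in the block being in increasing order. *)
Lemma prob_ascending (a b : nat) (F : pred {perm Sigma n p}) :
    (b <= n)%N ->
    (forall pi s, perm_on (block n a b) pi ->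
       F (move_positions pi * s)%g = F s) ->
  unif_prob (G n p) (fun s => F s && ascending a b (fun i => key (val0 s i)))
    = unif_prob (G n p) F / (b - a)`!%:R.
Proof.
move=> le_bn F_inv.
pose J := [set pi : {perm 'I_n} | perm_on (block n a b) pi].
have := @unif_prob_average _ (G_group n p) _ J move_positions F
  (fun s => ascending a b (fun i => key (val0 s i))) 1%N.
rewrite (_ : #|J| = (b - a)`!)%N; last first.
  by rewrite -(card_block a le_bn) -card_perm; apply: eq_card => pi; rewrite inE.
rewrite mul1r => <-; first by rewrite mulrC mulKf // pnatr_eq0 -lt0n fact_gt0.
- by move=> pi _; apply: move_positions_in_G.
- by move=> pi s; rewrite inE; apply: F_inv.
move=> s _; rewrite -[RHS](card_sorting_perm a le_bn (val0_inj (s := s))).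
apply: eq_card => pi; rewrite !inE; congr (_ && _).
by apply: eq_forallb => i; rewrite /= !val0_move_positions.
Qed.

Definition color_ratio : rat := #|C|%:R / p%:R.

Definition colors_from (a : nat) s : bool :=
  [forall i : 'I_n, (a <= i)%N ==> ((val0 s i).2 \in C)].

(** Of the p^n ways to shift the n colours of a given element independently,
   |C|^(n-a) p^a bring the last n-a colours into [C]. *)
Lemma prob_colors_from (a : nat) : (0 < p)%N -> (a <= n)%N ->
  unif_prob (G n p) (colors_from a) = color_ratio ^+ (n - a).
Proof.
move=> p_gt0 le_an.
have := @unif_prob_average _ (G_group n p) _ setT shift_colors predT
  (colors_from a) (#|C| ^ (n - a) * p ^ a).
have cardZ : #|Zmod p| = p by rewrite card_ord prednK.
rewrite unif_probT cardsT card_ffun cardZ card_ord mulr1 => avg.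
have p_neq0 : p%:R != 0 :> rat by rewrite pnatr_eq0 -lt0n.
have := avg; rewrite natrX => /(_ (fun c _ => shift_colors_in_G c)) => {}avg.
apply: (mulfI (expf_neq0 n p_neq0)); rewrite avg //; last first.
  move=> s Gs.
  have -> : #|[set c in setT | colors_from a (shift_colors c * s)%g]|
      = #|family (fun i : 'I_n =>
            [pred q : Zmod p | (a <= i)%N ==> ((val0 s i).2 + q \in C)])|.
    apply: eq_card => c; rewrite !inE; apply: eq_forallb => i.
    by rewrite color_shift_colors.
  rewrite card_family foldrE big_map big_enum /=.
  rewrite (bigID (fun i => i \in block n a n)) /=.
  rewrite (eq_bigr (fun => #|C|)) => [|i]; last first.
    rewrite inE ltn_ord andbT => le_ai.
    rewrite -[RHS](card_preimset C (addrI (val0 s i).2)); apply: eq_card => q.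
    by rewrite !inE le_ai.
  rewrite prod_nat_const card_block //; congr (_ * _)%N.
  rewrite (eq_bigl (mem (block n 0 a))) => [|i]; last first.
    by rewrite !inE ltn_ord andbT ltnNge.
  rewrite (eq_bigr (fun => p)) => [|i].
    by rewrite prod_nat_const card_block ?subn0.
  rewrite !inE /= => lt_ia; rewrite -[RHS]cardZ; apply: eq_card => q.
  by rewrite inE leqNgt lt_ia.
have -> : p%:R ^+ n = p%:R ^+ (n - a) * p%:R ^+ a :> rat.
  by rewrite -exprD subnK.
rewrite natrM !natrX expr_div_n.
by rewrite mulrAC [_ * (_ / _)]mulrC divfK ?expf_neq0.
Qed.

Definition ascent s (i : 'I_n) : bool :=
  if i.+1 == n then (val0 s i).2 \in C
  else (key (val0 s i) <= key (val0 s (ordS i)))%N.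

(** Positions are counted from 1 in [a] and [R], while the ordinal [i] stands for
   the position [i.+1]; so [a <= i] says that the position is beyond [a].
   Elements of [R] that are not beyond [a] have no effect. *)
Definition descents_from (a : nat) (R : seq nat) s : bool :=
  [forall i : 'I_n, (a <= i)%N ==> (ascent s i == (i.+1 \notin R))].

(** Position [b] is the only one between the block and the part beyond [b].  The
   list is allowed to contain [b] or not, so that one statement serves both
   cases of the recursion. *)
Lemma descents_from_split (a b : nat) (R : seq nat) s (l : 'I_n) :
    (a < b)%N -> l.+1 = b -> (forall c, c \in R -> (b <= c)%N) ->
  descents_from a R s
    = (descents_from b R s && ascending a b (fun i => key (val0 s i)))
        && (ascent s l == (b \notin R)).
Proof.
move=> lt_ab def_b R_ge; have lt_ln := ltn_ord l.
have ascE (i : 'I_n) : (i.+1 < b)%N ->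
    ascent s i = (key (val0 s i) <= key (val0 s (ordS i)))%N.
  by move=> lt_ib; rewrite /ascent ifF //; apply/eqP; lia.
have notR (i : 'I_n) : (i.+1 < b)%N -> i.+1 \notin R.
  by move=> lt_ib; apply: contraL lt_ib => /R_ge; rewrite leqNgt.
apply/forallP/andP => [desc|[/andP[/forallP desc /forallP asc] last_asc] i].
  split; last by have /implyP := desc l; rewrite def_b; apply; lia.
  apply/andP; split; apply/forallP => i; apply/implyP.
    by move=> le_bi; apply: (implyP (desc i)); lia.
  move=> /andP[le_ai lt_ib].
  by have := implyP (desc i) le_ai; rewrite ascE // notR // => /eqP.
apply/implyP => le_ai; have [lt_bi|lt_ib|eq_ib] := ltngtP b i.+1.
- exact: (implyP (desc i)).
- by rewrite ascE // notR // (implyP (asc i)) // le_ai.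
by rewrite -eq_ib (_ : i = l) //; apply/val_inj => /=; lia.
Qed.

Lemma descents_from_cons (b : nat) (R : seq nat) s :
  descents_from b (b :: R) s = descents_from b R s.
Proof.
apply: eq_forallb => i; case: (leqP b i) => //= le_bi.
by rewrite inE negb_or neq_ltn ltnS le_bi orbT.
Qed.

(** The last colour is in [C] and has the largest key, so [C_down] carries all
   earlier colours into [C]. *)
Lemma descents_from_nil (a : nat) s : (a <= n)%N ->
  descents_from a [::] s
    = colors_from a s && ascending a n (fun i => key (val0 s i)).
Proof.
move=> le_an.
apply/forallP/andP => [desc|[/forallP col /forallP asc] i]; last first.
  apply/implyP => le_ai; rewrite in_nil eqb_id /ascent.
  case: eqP => [_|neq_in]; first exact: (implyP (col i)).
  by apply: (implyP (asc i)); rewrite le_ai; have := ltn_ord i; lia.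
have asc : ascending a n (fun i => key (val0 s i)).
  apply/forallP => i; apply/implyP => /andP[le_ai lt_in].
  have := implyP (desc i) le_ai; rewrite in_nil eqb_id /ascent.
  by case: eqP => // eq_in; rewrite eq_in ltnn in lt_in.
split=> //; apply/forallP => i; apply/implyP => le_ai.
have lt_in := ltn_ord i; have lt_ln : (n.-1 < n)%N by lia.
pose l := Ordinal lt_ln.
have le_il : (i <= l)%N by rewrite /=; lia.
have := implyP (desc l) (leq_trans le_ai le_il).
rewrite in_nil eqb_id /ascent /= prednK ?eqxx; last lia.
by apply: C_down; apply: (ascendingP _ _ (leqnn n) asc); rewrite ?le_ai.
Qed.

Lemma prob_descents_from_nil (a : nat) : (0 < p)%N -> (a <= n)%N ->
  unif_prob (G n p) (descents_from a [::])
    = color_ratio ^+ (n - a) / (n - a)`!%:R.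
Proof.
move=> p_gt0 le_an; rewrite -prob_colors_from // -prob_ascending //.
  by apply: unif_prob_ext => s _; rewrite descents_from_nil.
move=> pi s pi_on.
have pi_ge (i : 'I_n) : (a <= pi i)%N = (a <= i)%N.
  by have := perm_closed i pi_on; rewrite !inE !ltn_ord !andbT.
apply/forallP/forallP => col i.
  by have := col ((pi^-1)%g i); rewrite -pi_ge val0_move_positions permKV.
by have := col (pi i); rewrite pi_ge val0_move_positions.
Qed.

(** Increasing between [a] and [b] and correct beyond [b]: position [b] is then
   either a descent or not, and these two cases are the two events compared. *)
Lemma prob_descents_from_cons (a b : nat) (R : seq nat) :
    (a < b <= n)%N -> (forall c, c \in R -> (b < c)%N) ->
  unif_prob (G n p) (descents_from a (b :: R))
    = unif_prob (G n p) (descents_from b R) / (b - a)`!%:R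
      - unif_prob (G n p) (descents_from a R).
Proof.
move=> /andP[lt_ab le_bn] R_gt; have lt_ln : (b.-1 < n)%N by lia.
pose l := Ordinal lt_ln; have def_b : l.+1 = b by rewrite /= prednK //; lia.
rewrite -prob_ascending //; last first.
  move=> pi s pi_on; have fix_ge (i : 'I_n) : (b <= i)%N -> pi i = i.
    by move=> le_bi; rewrite (out_perm pi_on) // inE ltnNge le_bi andbF.
  apply: eq_forallb => i; case: (leqP b i) => //= le_bi; congr (_ == _).
  rewrite /ascent !val0_move_positions fix_ge //; case: eqP => // neq_in.
  have lt_in : (i.+1 < n)%N by have := ltn_ord i; lia.
  by rewrite fix_ge //= modn_small // leqW.
pose asc s := ascending a b (fun i => key (val0 s i)).
transitivity (unif_prob (G n p)
    (fun s => (descents_from b R s && asc s) && ~~ ascent s l)).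
  apply: unif_prob_ext => s _; rewrite (descents_from_split _ lt_ab def_b).
    by rewrite descents_from_cons mem_head eqbF_neg.
  by move=> c; rewrite inE => /predU1P[->|/R_gt/ltnW].
rewrite unif_prob_diff; congr (_ - _); apply: unif_prob_ext => s _.
rewrite (descents_from_split _ lt_ab def_b) => [|c /R_gt/ltnW //].
by rewrite (_ : b \notin R) ?eqb_id //; apply/negP => /R_gt; rewrite ltnn.
Qed.

End ColoredPermutations.

(** * The descent set as a determinant *)

Lemma inv_fact_subn (a b : nat) : (a <= b)%N ->
  inv_fact (b%:Z - a%:Z) = (b - a)`!%:R^-1.
Proof. by move=> le_ab; rewrite subzn. Qed.

Lemma inv_fact_neg (a b : nat) : (b < a)%N -> inv_fact (b%:Z - a%:Z) = 0.
Proof.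
move=> lt_ba; rewrite -opprB subzn 1?ltnW //.
by have : (0 < a - b)%N by [rewrite subn_gt0]; case: (a - b)%N.
Qed.

Section DescentDeterminants.

Variables (n p : nat) (p_gt0 : (0 < p)%N).
Variables (key : Sigma n p -> nat) (C : {set Zmod p}).
Hypothesis key_inj : injective key.
Hypothesis C_down : forall x y, (key y <= key x)%N -> x.2 \in C -> y.2 \in C.
Variables (k : nat) (s : nat -> nat).
Hypothesis s_incr : forall i : nat, (i < k)%N -> (s i < s i.+1)%N.
Hypothesis s_k_le_n : (s k <= n)%N.
Hypothesis s_kS : s k.+1 = n.

Let x := color_ratio C.
Let D (i j : nat) : int := (s j.+1)%:Z - (s i)%:Z.

Lemma breaks_lt (i j : nat) : (i < j <= k)%N -> (s i < s j)%N.
Proof.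
case/andP; elim: j => // j IHj; rewrite ltnS leq_eqVlt => le_ij lt_jk.
have lt_s := s_incr lt_jk.
by case/predU1P: le_ij => [->|/IHj/(_ (ltnW lt_jk))/ltn_trans->].
Qed.

Lemma breaks_le (i j : nat) : (i <= j <= k)%N -> (s i <= s j)%N.
Proof.
case/andP; rewrite leq_eqVlt => /predU1P[-> //|lt_ij le_jk].
by rewrite ltnW // breaks_lt ?lt_ij.
Qed.

Lemma break_le_n (i : nat) : (i <= k)%N -> (s i <= n)%N.
Proof.
by move=> le_ik; rewrite (leq_trans _ s_k_le_n) // breaks_le ?le_ik /=.
Qed.

(** The family e(i,m) that obeys the recursion of [det_hessenberg];
   [exact_prob 0 0] is the probability of the whole descent set. *)
Definition exact_prob (i m : nat) : rat :=
  unif_prob (G n p)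
    (descents_from key C (s i) [seq s j | j <- iota m.+1 (k - m)]).

Lemma exact_prob_rec (i m : nat) : (i <= m < k)%N ->
  exact_prob i m = inv_fact (D i m) * exact_prob m.+1 m.+1 - exact_prob i m.+1.
Proof.
case/andP=> le_im lt_mk; have lt_s : (s i < s m.+1)%N by apply: breaks_lt; lia.
rewrite /exact_prob [(k - m)%N](_ : _ = (k - m.+1).+1); last lia.
rewrite prob_descents_from_cons ?lt_s ?break_le_n //.
  by rewrite inv_fact_subn 1?ltnW // [_ * _^-1]mulrC.
by move=> c /mapP[j]; rewrite mem_iota => bj ->; apply: breaks_lt; lia.
Qed.

Lemma exact_prob_last (i : nat) : (i <= k)%N ->
  exact_prob i k = inv_fact (D i k) * x ^ D i k.
Proof.
move=> le_ik; have le_sn := break_le_n le_ik.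
rewrite /exact_prob subnn /= prob_descents_from_nil //.
by rewrite /D s_kS inv_fact_subn // subzn // mulrC.
Qed.

Lemma inv_fact_low (i j : nat) : (j < i <= k)%N ->
  inv_fact (D i j) = (i == j.+1)%:R.
Proof.
case/andP; rewrite leq_eqVlt => /predU1P[<- _|lt_ji le_ik].
  by rewrite inv_fact_subn // subnn eqxx.
by rewrite inv_fact_neg ?(gtn_eqF lt_ji) // breaks_lt // lt_ji.
Qed.

Lemma exact_prob_det :
  exact_prob 0 0 = \det (\matrix_(i < k.+1, j < k.+1)
    if (j < k)%N then inv_fact (D i j) else inv_fact (D i j) * x ^ D i j).
Proof.
pose M i j := if (j < k)%N then inv_fact (D i j)
              else inv_fact (D i j) * x ^ D i j.
rewrite -(@det_hessenberg _ k M) // /M => [i j|i le_ik|i m le_im lt_mk].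
- by move=> ltle; rewrite ifT ?inv_fact_low //; lia.
- by rewrite ltnn exact_prob_last.
by rewrite lt_mk exact_prob_rec ?le_im.
Qed.

(** When [s k = n], row and column [k] are superfluous because
   [exact_prob k k = 1]; the recursion can start one index lower. *)
Lemma exact_prob_det_last : (0 < k)%N -> s k = n ->
  exact_prob 0 0 = \det (\matrix_(i < k, j < k)
    if (j < k.-1)%N then inv_fact (D i j)
    else inv_fact (D i j) * (1 - x ^ D i j)).
Proof.
move=> k_gt0 s_k.
pose M i j := if (j < k.-1)%N then inv_fact (D i j)
              else inv_fact (D i j) * (1 - x ^ D i j).
have := @det_hessenberg _ k.-1 M exact_prob; rewrite prednK // => <- //.
- move=> i j ltle; rewrite /M ifT ?inv_fact_low //; lia.
- move=> i le_ik; rewrite exact_prob_rec; last lia.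
  rewrite prednK // !exact_prob_last; try lia.
  rewrite /M ltnn /D prednK // s_kS s_k subrr mulr1.
  by rewrite mulrBr mulr1.
by move=> i m le_im lt_mk; rewrite /M lt_mk exact_prob_rec //; lia.
Qed.

Lemma prob_descent_set (des : {perm Sigma n p} -> 'I_n -> bool) : s 0%N = 0%N ->
    (forall sigma i, des sigma i = ~~ ascent key C sigma i) ->
  unif_prob (G n p) (fun sigma => [set i | des sigma i] == positions n k s)
    = exact_prob 0 0.
Proof.
move=> s_0 desE; apply: unif_prob_ext => sigma _; rewrite s_0 subn0.
apply/eqP/forallP => [/setP eq_des i|desc].
  by have := eq_des i; rewrite !inE desE => <-; rewrite negbK eqxx.
by apply/setP => i; rewrite !inE desE (eqP (desc i)) negbK.
Qed.

End DescentDeterminants.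

(** * The two orders *)

Definition lex_key (n p : nat) (rank : Zmod p -> nat) (x : Sigma n p) : nat :=
  rank x.2 * n + x.1.

Section LexKey.

Variables (n p : nat) (rank : Zmod p -> nat).
Hypothesis rank_inj : injective rank.

Lemma lex_key_lt (x y : Sigma n p) : (lex_key rank x < lex_key rank y)%N
  = (rank x.2 < rank y.2)%N || ((x.2 == y.2) && (x.1 < y.1)%N).
Proof.
rewrite -(inj_eq rank_inj) /lex_key.
have := ltn_ord x.1; have := ltn_ord y.1.
move: (rank x.2) (rank y.2) (nat_of_ord x.1) (nat_of_ord y.1) => a b i j.
by case: ltngtP => /= [||->]; nia.
Qed.

Lemma lex_key_inj : injective (@lex_key n p rank).
Proof.
move=> x y eq_key; have := lex_key_lt x y; have := lex_key_lt y x.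
rewrite eq_key ltnn; case: ltngtP => //= /rank_inj eq_c.
rewrite eq_c eqxx /= => /esym le_xy /esym le_yx.
have eq_i : x.1 = y.1 by apply/ord_inj; case: ltngtP le_xy le_yx.
by rewrite [x]surjective_pairing [y]surjective_pairing eq_c eq_i.
Qed.

Lemma lex_key_le_rank (x y : Sigma n p) :
  (lex_key rank x <= lex_key rank y)%N -> (rank x.2 <= rank y.2)%N.
Proof. by rewrite leqNgt lex_key_lt negb_or -leqNgt => /andP[]. Qed.

End LexKey.

(** The colour blocks of the d-order come in the order 0, p-1, ..., 1. *)
Definition d_rank (p : nat) (q : Zmod p) : nat := (- q : Zmod p).

Lemma d_rank_inj (p : nat) : injective (@d_rank p).
Proof. by move=> q r /val_inj/oppr_inj. Qed.

Definition d'_rank (p : nat) (q : Zmod p) : nat := q.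

Lemma d'_rank_inj (p : nat) : injective (@d'_rank p).
Proof. exact: val_inj. Qed.

Lemma d_descentE (n p : nat) (sigma : {perm Sigma n p}) (i : 'I_n) :
  d_descent sigma i = ~~ ascent (lex_key (@d_rank p)) [set 0] sigma i.
Proof.
rewrite /d_descent /ascent; case: ifP => _; first by rewrite inE.
by rewrite -ltnNge lex_key_lt //; exact: d_rank_inj.
Qed.

Lemma d'_descentE (n p : nat) (sigma : {perm Sigma n p}) (i : 'I_n) :
  d'_descent sigma i = ~~ ascent (lex_key (@d'_rank p)) [set~ ord_max] sigma i.
Proof.
rewrite /d'_descent /ascent; case: ifP => _; first by rewrite !inE negbK.
by rewrite -ltnNge lex_key_lt //; exact: d'_rank_inj.
Qed.

Lemma d_colors_down (n p : nat) (x y : Sigma n p) :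
    (lex_key (@d_rank p) y <= lex_key (@d_rank p) x)%N ->
  x.2 \in [set 0 : Zmod p] -> y.2 \in [set 0 : Zmod p].
Proof.
move=> /(lex_key_le_rank (@d_rank_inj p)) le_yx; rewrite !inE => /eqP x_0.
by move: le_yx; rewrite x_0 /d_rank oppr0 leqn0 -oppr_eq0.
Qed.

Lemma d'_colors_down (n p : nat) (x y : Sigma n p) :
    (lex_key (@d'_rank p) y <= lex_key (@d'_rank p) x)%N ->
  x.2 \in [set~ ord_max : Zmod p] -> y.2 \in [set~ ord_max : Zmod p].
Proof.
move=> /(lex_key_le_rank (@d'_rank_inj p)) le_yx; rewrite !inE.
apply: contraNneq => y_max; apply/eqP/val_inj/eqP; rewrite eqn_leq.
by rewrite -ltnS ltn_ord /= (leq_trans _ le_yx) // y_max.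
Qed.

Lemma d_color_ratio (p : nat) : color_ratio [set 0 : Zmod p] = p%:R^-1.
Proof. by rewrite /color_ratio cards1 mul1r. Qed.

Lemma d'_color_ratio (p : nat) : (0 < p)%N ->
  color_ratio [set~ ord_max : Zmod p] = inv_dual p.
Proof.
move=> p_gt0; rewrite /color_ratio cardsC1 card_ord /= /inv_dual -subn1 natrB //.
by rewrite mulrBl divff ?mul1r // pnatr_eq0 -lt0n.
Qed.

Theorem corollary1p4 (n p : nat) (n_gt0 : (0 < n)%N) (p_gt0 : (0 < p)%N)
    (k : nat) (k_gt0 : (0 < k)%N) (k_le_n : (k <= n)%N)
    (s : nat -> nat) (s_0 : s 0%N = 0%N)
    (s_incr : forall i : nat, (i < k)%N -> (s i < s i.+1)%N)
    (s_k_le_n : (s k <= n)%N) (s_kS : s k.+1 = n) :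
  let D (i j : nat) : int := (s j.+1)%:Z - (s i)%:Z in
  (((s k < n)%N ->
      P_unif n p k s =
      \det (\matrix_(i < k.+1, j < k.+1)
              if (j < k)%N then inv_fact (D i j)
              else inv_fact (D i j) * (p%:R^-1) ^ (D i j)))
   /\
   (s k = n ->
      P_unif n p k s =
      \det (\matrix_(i < k, j < k)
              if (j < k.-1)%N then inv_fact (D i j)
              else inv_fact (D i j) * (1 - (p%:R^-1) ^ (D i j)))))
  /\
  (((s k < n)%N ->
      P'_unif n p k s =
      \det (\matrix_(i < k.+1, j < k.+1)
              if (j < k)%N then inv_fact (D i j)
              else inv_fact (D i j) * (inv_dual p) ^ (D i j)))
   /\
   (s k = n ->
      P'_unif n p k s =
      \det (\matrix_(i < k, j < k)
              if (j < k.-1)%N then inv_fact (D i j)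
              else inv_fact (D i j) * (1 - (inv_dual p) ^ (D i j))))).
Proof.
move=> D; rewrite /P_unif /P'_unif.
rewrite (prob_descent_set k s_0 (@d_descentE n p)).
rewrite (prob_descent_set k s_0 (@d'_descentE n p)).
rewrite -d_color_ratio -d'_color_ratio //.
have key_inj := lex_key_inj (n := n) (@d_rank_inj p).
have key'_inj := lex_key_inj (n := n) (@d'_rank_inj p).
split; split=> *.
- exact: (exact_prob_det p_gt0 key_inj (@d_colors_down n p)).
- exact: (exact_prob_det_last p_gt0 key_inj (@d_colors_down n p)).
- exact: (exact_prob_det p_gt0 key'_inj (@d'_colors_down n p)).
exact: (exact_prob_det_last p_gt0 key'_inj (@d'_colors_down n p)).
Qed.
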